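(* Let $\psi(\cdot)=[\psi_1(\cdot),\dots,\psi_s(\cdot)]^T$ be any set of basis functions that span an $s$-dimensional function space $C_d^s$ on $[0,1]$, and let $c_1,\dots,c_s$ be control points such that the matrix $M=[\psi_i(c_j)]_{i,j=1}^s$ is invertible. Let $\phi(\cdot)=[\phi_1(\cdot),\dots,\phi_s(\cdot)]^T=M^{-1}\psi(\cdot)$, so that $\phi_i(c_j)=\delta_{ij}$, and consider the quadrature formula $\int_0^1f(\tau)\,d\tau\approx\sum_{i=1}^sb_if(c_i)$ with weights $b_i=\int_0^1\phi_i(\tau)\,d\tau$, where $b_i\neq0$ for all $i$. Then the associated generalized Galerkin Hamiltonian variational integrator $$q_1=q_0+h\sum_{i=1}^sB_iV^i,\qquad p_1=p_0-h\sum_{i=1}^sb_i\frac{\partial H}{\partial q}(Q^i,P^i),\qquad Q^i=q_0+h\sum_{j=1}^sA_{ij}V^j,$$ $$0=\sum_{i=1}^sb_iP^i\psi_j(c_i)-p_0B_j+h\sum_{i=1}^s(b_iB_j-b_iA_{ij})\frac{\partial H}{\partial q}(Q^i,P^i),\qquad 0=\sum_{i=1}^s\psi_i(c_j)V^i-\frac{\partial H}{\partial p}(Q^j,P^j)$$ (with $Q^i$ given for $i=1,\dots,s$ and the last two equations holding for $j=1,\dots,s$) can be implemented by the following $s$-stage symplectic partitioned Runge--Kutta method applied to Hamilton's equations $\dot q=\partial H/\partial p$, $\dot p=-\partial H/\partial q$: $$q_1=q_0+h\sum_{i=1}^sb_i\frac{\partial H}{\partial p}(Q^i,P^i),\qquad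 p_1=p_0-h\sum_{i=1}^sb_i\frac{\partial H}{\partial q}(Q^i,P^i),$$ $$Q^i=q_0+h\sum_{j=1}^sa_{ij}\frac{\partial H}{\partial p}(Q^j,P^j),\qquad P^i=p_0-h\sum_{j=1}^s\tilde a_{ij}\frac{\partial H}{\partial q}(Q^j,P^j),\qquad i=1,\dots,s,$$ where $b_i=\int_0^1\phi_i(\tau)\,d\tau\neq0$, $a_{ij}=\int_0^{c_i}\phi_j(\tau)\,d\tau$ and $\tilde a_{ij}=\dfrac{b_ib_j-b_ja_{ji}}{b_i}$.
   Context: $Q$ is an $n$-dimensional configuration manifold, and one works in coordinates $(q,p)$ on $T^*Q$; $H:T^*Q\to\mathbb{R}$ is a Hamiltonian and $h$ is the time step. The coefficients of the Galerkin system are $B_i=\int_0^1\psi_i(\tau)\,d\tau$ and $A_{ij}=\int_0^{c_i}\psi_j(\tau)\,d\tau$. The generalized Galerkin Hamiltonian variational integrator is built by approximating the velocity on $[0,h]$ by $\dot q_d(\tau h)=\sum_{i=1}^sV^i\psi_i(\tau)$ and the position by $q_d(\tau h)=q_0+h\sum_{i=1}^sV^i\int_0^\tau\psi_i(\rho)\,d\rho$. The internal stages are $Q^i=q_d(c_ih)$, and $P^i$ is the momentum at time $c_ih$. The integrator is the map $(q_0,p_0)\mapsto(q_1,p_1)$ given by $p_0=D_1H_d^+(q_0,p_1)$, $q_1=D_2H_d^+(q_0,p_1)$ (with $D_1,D_2$ the partial derivatives in the first and second arguments) for the discrete right Hamiltonian function $$H_d^+(q_0,p_1)=\operatorname*{ext}_{V^i,P^i}\left\{p_1\Big(q_0+h\sum_{i=1}^sB_iV^i\Big)-h\sum_{i=1}^sb_i\Big[P^i\sum_{j=1}^sV^j\psi_j(c_i)-H\Big(q_0+h\sum_{j=1}^sA_{ij}V^j,P^i\Big)\Big]\right\},$$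 where $\operatorname{ext}$ denotes the extremal (stationary) value; it takes the form of the displayed system of equations. Symplectic means that the one-step map $(q_0,p_0)\mapsto(q_1,p_1)$ preserves the canonical two-form, $dp_1\wedge dq_1=dp_0\wedge dq_0$. *)

(* Defs.v *)
From HB Require Import structures.
From mathcomp Require Import all_boot all_order all_algebra.
From mathcomp Require Import all_classical all_reals all_analysis.

Set Implicit Arguments.
Unset Strict Implicit.
Unset Printing Implicit Defensive.

Import Order.TTheory GRing.Theory Num.Theory.
Import numFieldNormedType.Exports.

Local Open Scope classical_set_scope.
Local Open Scope ring_scope.

(** * Calculus on phase space

    In coordinates, positions and momenta are both row vectors, and a point
    (q, p) of T*Q is an element of ['rV[R]_n * 'rV[R]_n]. *)

Definition dot (R : realType) (n : nat) (u v : 'rV[R]_n) : R :=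
  \sum_(k < n) u 0 k * v 0 k.

Definition grad1 (R : realType) (n : nat)
    (F : 'rV[R]_n * 'rV[R]_n -> R) (x y : 'rV[R]_n) : 'rV[R]_n :=
  \row_(k < n) 'D_(delta_mx 0 k) (fun x' : 'rV[R]_n => F (x', y)) x.

Definition grad2 (R : realType) (n : nat)
    (F : 'rV[R]_n * 'rV[R]_n -> R) (x y : 'rV[R]_n) : 'rV[R]_n :=
  \row_(k < n) 'D_(delta_mx 0 k) (fun y' : 'rV[R]_n => F (x, y')) y.

Definition C2_on (R : realType) (n : nat) (D : set ('rV[R]_n * 'rV[R]_n))
    (F : 'rV[R]_n * 'rV[R]_n -> R) : Prop :=
  forall z, D z ->
    differentiable F z /\
    forall v, differentiable ('D_v F) z /\
    forall w, {for z, continuous ('D_w ('D_v F))}.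

Definition critical_point (R : realType) (V : normedModType R)
    (f : V -> R) (x : V) : Prop :=
  differentiable f x /\ forall v, 'd f x v = 0.

(* [dp /\ dq] evaluated on two tangent vectors, each given as a pair
   (variation of q, variation of p). *)
Definition canonical_two_form (R : realType) (n : nat)
    (u v : 'rV[R]_n * 'rV[R]_n) : R :=
  dot u.2 v.1 - dot v.2 u.1.

Definition symplectic_on (R : realType) (n : nat)
    (E : set ('rV[R]_n * 'rV[R]_n))
    (Phi : 'rV[R]_n * 'rV[R]_n -> 'rV[R]_n * 'rV[R]_n) : Prop :=
  forall z, E z ->
    differentiable Phi z /\
    forall u v, canonical_two_form ('d Phi z u) ('d Phi z v) =
                canonical_two_form u v.

(** * Basis functions and coefficients *)

Definition integral_to (R : realType) (t : R) (f : R -> R) : R :=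
  \int[@lebesgue_measure R]_(x in `[0, t]) f x.

Definition lin_indep01 (R : realType) (s : nat) (psi : 'I_s -> R -> R) : Prop :=
  forall a : 'I_s -> R,
    (forall t, t \in `[0, 1] -> \sum_(i < s) a i * psi i t = 0) ->
    forall i, a i = 0.

Definition control_matrix (R : realType) (s : nat)
    (psi : 'I_s -> R -> R) (c : 'I_s -> R) : 'M[R]_s :=
  \matrix_(i < s, j < s) psi i (c j).

Definition nodal_basis (R : realType) (s : nat)
    (psi : 'I_s -> R -> R) (c : 'I_s -> R) (i : 'I_s) (t : R) : R :=
  \sum_(k < s) invmx (control_matrix psi c) i k * psi k t.

Definition full_coef (R : realType) (s : nat)
    (psi : 'I_s -> R -> R) (i : 'I_s) : R :=
  integral_to 1 (psi i).

Definition stage_coef (R : realType) (s : nat)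
    (psi : 'I_s -> R -> R) (c : 'I_s -> R) (i j : 'I_s) : R :=
  integral_to (c i) (psi j).

(* The coefficients of the momentum stages of the partitioned method. *)
Definition conj_coef (R : realType) (s : nat)
    (b : 'I_s -> R) (a : 'I_s -> 'I_s -> R) (i j : 'I_s) : R :=
  (b i * b j - b j * a j i) / b i.

(** * The generalized Galerkin Hamiltonian variational integrator

    The families (V^i), (Q^i), (P^i) of s vectors are the rows of s x n
    matrices. *)

Definition galerkin_stages (R : realType) (s n : nat)
    (psi : 'I_s -> R -> R) (c : 'I_s -> R) (h : R)
    (q0 : 'rV[R]_n) (V : 'M[R]_(s, n)) : 'M[R]_(s, n) :=
  \matrix_(i < s) (q0 + h *: \sum_(j < s) stage_coef psi c i j *: row j V).

(* The expression whose stationary value over (V, P) is the discrete right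
   Hamiltonian H_d^+(q0, p1). *)
Definition galerkin_action (R : realType) (s n : nat)
    (psi : 'I_s -> R -> R) (c b : 'I_s -> R)
    (H : 'rV[R]_n * 'rV[R]_n -> R) (h : R)
    (q0 p1 : 'rV[R]_n) (X : 'M[R]_(s, n) * 'M[R]_(s, n)) : R :=
  let: (V, P) := X in
  dot p1 (q0 + h *: \sum_(i < s) full_coef psi i *: row i V)
  - h * \sum_(i < s) b i *
      (dot (row i P) (\sum_(j < s) psi j (c i) *: row j V)
       - H (row i (galerkin_stages psi c h q0 V), row i P)).

(* "ext": a differentiable choice, for (q0, p1) in E, of a stationary point
   (V, P) of the action whose internal stages stay in the coordinate domain U. *)
Definition stationary_branch (R : realType) (s n : nat)
    (psi : 'I_s -> R -> R) (c b : 'I_s -> R) (U : set 'rV[R]_n)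
    (H : 'rV[R]_n * 'rV[R]_n -> R) (h : R)
    (E : set ('rV[R]_n * 'rV[R]_n))
    (X : 'rV[R]_n * 'rV[R]_n -> 'M[R]_(s, n) * 'M[R]_(s, n)) : Prop :=
  open E /\
  forall z, E z ->
    [/\ differentiable X z,
        forall i, U (row i (galerkin_stages psi c h z.1 (X z).1)) &
        critical_point (galerkin_action psi c b H h z.1 z.2) (X z)].

Definition discrete_right_hamiltonian (R : realType) (s n : nat)
    (psi : 'I_s -> R -> R) (c b : 'I_s -> R)
    (H : 'rV[R]_n * 'rV[R]_n -> R) (h : R)
    (X : 'rV[R]_n * 'rV[R]_n -> 'M[R]_(s, n) * 'M[R]_(s, n))
    (z : 'rV[R]_n * 'rV[R]_n) : R :=
  galerkin_action psi c b H h z.1 z.2 (X z).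

Definition galerkin_system (R : realType) (s n : nat)
    (psi : 'I_s -> R -> R) (c b : 'I_s -> R)
    (H : 'rV[R]_n * 'rV[R]_n -> R) (h : R)
    (q0 p0 q1 p1 : 'rV[R]_n) (Q P V : 'M[R]_(s, n)) : Prop :=
  [/\ q1 = q0 + h *: \sum_(i < s) full_coef psi i *: row i V,
      p1 = p0 - h *: \sum_(i < s) b i *: grad1 H (row i Q) (row i P),
      forall i, row i Q =
        q0 + h *: \sum_(j < s) stage_coef psi c i j *: row j V,
      forall j, 0 =
        \sum_(i < s) (b i * psi j (c i)) *: row i P
        - full_coef psi j *: p0
        + h *: \sum_(i < s)
            (b i * full_coef psi j - b i * stage_coef psi c i j)
              *: grad1 H (row i Q) (row i P) &
      forall j, 0 =
        \sum_(i < s) psi i (c j) *: row i V - grad2 H (row j Q) (row j P)].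

(** * Partitioned Runge-Kutta methods for Hamilton's equations *)

Definition prk_system (R : realType) (s n : nat)
    (b : 'I_s -> R) (a at_ : 'I_s -> 'I_s -> R)
    (H : 'rV[R]_n * 'rV[R]_n -> R) (h : R)
    (q0 p0 q1 p1 : 'rV[R]_n) (Q P : 'M[R]_(s, n)) : Prop :=
  [/\ q1 = q0 + h *: \sum_(i < s) b i *: grad2 H (row i Q) (row i P),
      p1 = p0 - h *: \sum_(i < s) b i *: grad1 H (row i Q) (row i P),
      forall i, row i Q =
        q0 + h *: \sum_(j < s) a i j *: grad2 H (row j Q) (row j P) &
      forall i, row i P =
        p0 - h *: \sum_(j < s) at_ i j *: grad1 H (row j Q) (row j P)].

(* The method is implicit: a one-step map on E comes with internal stages
   solving the system, depending differentiably on (q0, p0). *)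
Definition prk_one_step_map (R : realType) (s n : nat)
    (b : 'I_s -> R) (a at_ : 'I_s -> 'I_s -> R) (U : set 'rV[R]_n)
    (H : 'rV[R]_n * 'rV[R]_n -> R) (h : R)
    (E : set ('rV[R]_n * 'rV[R]_n))
    (Phi : 'rV[R]_n * 'rV[R]_n -> 'rV[R]_n * 'rV[R]_n) : Prop :=
  open E /\
  exists Q P : 'rV[R]_n * 'rV[R]_n -> 'M[R]_(s, n),
  forall z, E z ->
    [/\ differentiable Q z, differentiable P z,
        forall i, U (row i (Q z)) &
        prk_system b a at_ H h z.1 z.2 (Phi z).1 (Phi z).2 (Q z) (P z)].

Definition symplectic_prk (R : realType) (s n : nat)
    (b : 'I_s -> R) (a at_ : 'I_s -> 'I_s -> R) (U : set 'rV[R]_n)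
    (H : 'rV[R]_n * 'rV[R]_n -> R) (h : R) : Prop :=
  forall E Phi, prk_one_step_map b a at_ U H h E Phi -> symplectic_on E Phi.

(* Main.v *)
(* The gradient of H_d^+ is computed by the envelope theorem: at a stationary
   point of the action, the variation of the stages drops out.  Stationarity in V
   and in P gives the last two equations of the Galerkin system, and expressing
   psi in the nodal basis phi turns these into the stage equations of the
   partitioned method.  Symplecticity holds because
   b_i at_ij + b_j a_ji = b_i b_j cancels all cross terms between stages, after
   which only the antisymmetrization of the Hessian of H remains, and the Hessian
   is symmetric (Schwarz). *)
Require Import Defs.
From HB Require Import structures.
From mathcomp Require Import all_boot all_order all_algebra.
From mathcomp Require Import all_classical all_reals all_analysis.
From mathcomp Require Import ring.

Set Implicit Arguments.
Unset Strict Implicit.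
Unset Printing Implicit Defensive.

Import Order.TTheory GRing.Theory Num.Theory.
Import numFieldNormedType.Exports.

Local Open Scope classical_set_scope.
Local Open Scope ring_scope.

(** * Differentiation rules *)

Section is_diff_facts.
Context {R : realType}.
Implicit Types V W : normedModType R.

Lemma is_diff_sum V W (I : Type) (r : seq I) (f df : I -> V -> W) x :
  (forall i, is_diff x (f i) (df i)) ->
  is_diff x (fun z => \sum_(i <- r) f i z) (fun v => \sum_(i <- r) df i v).
Proof.
move=> fdf; elim: r => [|i r IH].
  have -> : (fun z => \sum_(i <- [::]) f i z) = cst 0.
    by apply/funext => z; rewrite big_nil.
  apply: is_diff_eq.
  by apply/funext => v; rewrite big_nil.
have -> : (fun z => \sum_(j <- i :: r) f j z) =
          f i + (fun z => \sum_(j <- r) f j z).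
  by apply/funext => z; rewrite big_cons.
apply: is_diff_eq.
by apply/funext => v; rewrite big_cons.
Qed.

Lemma is_diff_scale V W k (f df : V -> W) x :
  is_diff x f df -> is_diff x (fun z => k *: f z) (fun v => k *: df v).
Proof. exact: is_diffZ. Qed.

Lemma is_diff_scale_cst V W (f df : V -> R) (w : W) x :
  is_diff x f df -> is_diff x (fun z => f z *: w) (fun v => df v *: w).
Proof.
move=> fdf; apply: DiffDef; first exact: differentiableZl.
by rewrite diffZl // diff_val.
Qed.

Lemma is_diff_mul V (f df g dg : V -> R) x :
  is_diff x f df -> is_diff x g dg ->
  is_diff x (fun z => f z * g z) (fun v => df v * g x + f x * dg v).
Proof.
move=> fdf gdg; apply: is_diff_eq.
by apply/funext => v; rewrite addrC /= mulrC.
Qed.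

Lemma is_diff_add V W (f df g dg : V -> W) x :
  is_diff x f df -> is_diff x g dg ->
  is_diff x (fun z => f z + g z) (fun v => df v + dg v).
Proof. by move=> fdf gdg; apply: is_diffD. Qed.

Lemma is_diff_sub V W (f df g dg : V -> W) x :
  is_diff x f df -> is_diff x g dg ->
  is_diff x (fun z => f z - g z) (fun v => df v - dg v).
Proof. by move=> fdf gdg; apply: is_diffB. Qed.

Lemma is_diff_fst V W (U : normedModType R) (f df : U -> V * W) x :
  is_diff x f df -> is_diff x (fun z => (f z).1) (fun v => (df v).1).
Proof.
move=> fdf.
have fst1 y : is_diff y (@fst V W) fst.
  have c : continuous (@fst V W) by move=> ?; exact: cvg_fst.
  by apply: DiffDef; [exact: linear_differentiable|exact: diff_lin].
exact: (@is_diff_comp _ _ _ _ _ _ fst fst).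
Qed.

Lemma is_diff_snd V W (U : normedModType R) (f df : U -> V * W) x :
  is_diff x f df -> is_diff x (fun z => (f z).2) (fun v => (df v).2).
Proof.
move=> fdf.
have snd1 y : is_diff y (@snd V W) snd.
  have c : continuous (@snd V W) by move=> ?; exact: cvg_snd.
  by apply: DiffDef; [exact: linear_differentiable|exact: diff_lin].
exact: (@is_diff_comp _ _ _ _ _ _ snd snd).
Qed.

Lemma is_diff_coord V m n (f df : V -> 'M[R]_(m, n)) x i j :
  is_diff x f df -> is_diff x (fun z => f z i j) (fun v => df v i j).
Proof.
move=> fdf.
have lin : linear (fun M : 'M[R]_(m, n) => M i j) by move=> k A B; rewrite !mxE.
pose Lm := GRing.isLinear.Build _ _ _ _ _ lin.
pose L : {linear 'M[R]_(m, n) -> R} :=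
  HB.pack (fun M : 'M[R]_(m, n) => M i j) Lm.
have c : continuous L by move=> M; exact: coord_continuous.
have dL : is_diff (f x) L L.
  by apply: DiffDef; [exact: linear_differentiable|exact: diff_lin].
exact: (@is_diff_comp _ _ _ _ _ _ L L).
Qed.

(** A matrix is the sum of its entries times constant elementary matrices, so differentiability can
    be tested entrywise. *)
Lemma is_diff_mx V m n (f df : V -> 'M[R]_(m, n)) x :
  (forall i j, is_diff x (fun z => f z i j) (fun v => df v i j)) ->
  is_diff x f df.
Proof.
move=> fdf.
have -> : f = fun z => \sum_i \sum_j f z i j *: delta_mx i j.
  by apply/funext => z; rewrite -matrix_sum_delta.
have -> : df = fun v => \sum_i \sum_j df v i j *: delta_mx i j.
  by apply/funext => z; rewrite -matrix_sum_delta.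
do 2 (apply: is_diff_sum => ?); exact: is_diff_scale_cst.
Qed.

Lemma is_diff_row V m n (f df : V -> 'M[R]_(m, n)) x i :
  is_diff x f df -> is_diff x (fun z => row i (f z)) (fun v => row i (df v)).
Proof.
move=> fdf; apply: is_diff_mx => k j.
have -> : (fun z => row i (f z) k j) = fun z => f z i j.
  by apply/funext => z; rewrite mxE.
apply: is_diff_eq; first exact: is_diff_coord.
by apply/funext => z; rewrite mxE.
Qed.

Lemma is_diff_dot V n (f df g dg : V -> 'rV[R]_n) x :
  is_diff x f df -> is_diff x g dg ->
  is_diff x (fun z => dot (f z) (g z))
            (fun v => dot (df v) (g x) + dot (f x) (dg v)).
Proof.
move=> fdf gdg; apply: is_diff_eq.
  by apply: is_diff_sum => k; apply: is_diff_mul; exact: is_diff_coord.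
by apply/funext => v; rewrite -big_split.
Qed.

(** The difference [g - f] vanishes near [x], so it has zero differential there, and
    [g = f + (g - f)]. *)
Lemma near_eq_is_diff V W (f g df : V -> W) x :
  (\near x, f x = g x) -> is_diff x f df -> is_diff x g df.
Proof.
move=> fg fdf.
have gf : differentiable (g - f) x /\ 'd (g - f) x = cst 0 :> (V -> W).
  have E : (g - f) \o shift x = cst ((g - f) x) + cst 0 +o_ 0 id.
    apply/eqaddoP => _/posnumP[e]; near=> y.
    rewrite /= !fctE /= (nbhs_singleton fg) subrr addr0 subr0.
    suff -> : f (y + x) = g (y + x) by rewrite subrr normr0 mulr_ge0.
    by near: y; move: fg; rewrite (near_shift 0) /= subr0.
  have c0 : continuous (\0 : {linear V -> W}) by move=> ?; exact: cvg_cst.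
  have d0 := @diff_unique _ _ _ (g - f) \0 x c0 E.
  by split; first by apply/diff_locallyP; rewrite d0.
have -> : g = f + (g - f) by apply/funext => y; rewrite !fctE subrKC.
have gf' : is_diff x (g - f) (cst 0) by case: gf; exact: DiffDef.
by apply: (is_diff_eq (is_diffD fdf gf'));
  apply/funext => v; rewrite !fctE addr0.
Unshelve. all: by end_near. Qed.

(** Differentials are unique, so an equation valid on a neighbourhood may be differentiated on both
    sides. This is how the implicit stage equations get linearized. *)
Lemma near_eq_diff V W (f g df dg : V -> W) x :
  (\near x, f x = g x) -> is_diff x f df -> is_diff x g dg -> df =1 dg.
Proof.
move=> fg fdf gdg v; have fdg := near_eq_is_diff fg fdf.
by rewrite -(@diff_val _ _ _ _ _ _ _ gdg) (@diff_val _ _ _ _ _ _ _ fdg).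
Qed.

End is_diff_facts.

(** * Symmetry of second derivatives *)

Section schwarz.
Context {R : realType} {V : normedModType R}.
Implicit Types (F : V -> R) (v w y z : V) (t : R).

(** The difference quotient of [F] restricted to the line is the directional quotient of [F] at
    [y + t *: v]; one-variable calculus thus applies. *)
Lemma derive_line F y v t :
  is_derive t 1 (fun x => F (y + x *: v)) ('D_v F (y + t *: v)) <->
  derivable F (y + t *: v) v.
Proof.
have E : (fun h : R => h^-1 *: (((fun x => F (y + x *: v)) \o shift t) (h *: 1)
              - F (y + t *: v))) =
         (fun h => h^-1 *: ((F \o shift (y + t *: v)) (h *: v) - F (y + t *: v))).
  apply/funext => h /=; congr (_ *: (F _ - _)).
  by rewrite scalerDl [h *: 1]mulr1 addrCA.
split=> [[]|d]; first by rewrite /derivable E.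
by split; rewrite /derivable ?/derive E.
Qed.

Lemma derivable_comp_shift F y v w :
  derivable F (y + w) v -> is_derive y v (fun x => F (x + w)) ('D_v F (y + w)).
Proof.
move=> d.
have E : (fun h : R => h^-1 *: (((fun x => F (x + w)) \o shift y) (h *: v)
              - F (y + w))) =
         (fun h => h^-1 *: ((F \o shift (y + w)) (h *: v) - F (y + w))).
  by apply/funext => h /=; rewrite addrA.
by split; rewrite /derivable ?/derive E.
Qed.

Lemma MVT_line F y v t : 0 < t ->
  (forall x, x \in `[0, t] -> derivable F (y + x *: v) v) ->
  exists2 x, x \in `[0, t] & F (y + t *: v) - F y = t * 'D_v F (y + x *: v).
Proof.
move=> t0 d.
pose g x := F (y + x *: v).
have dg x : x \in `[0, t] -> is_derive x 1 g ('D_v F (y + x *: v)).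
  by move=> xt; apply/derive_line/d.
have dg' x : x \in `]0, t[ -> is_derive x 1 g ('D_v F (y + x *: v)).
  by move=> /subset_itv_oo_cc; exact: dg.
have cg : {within `[0, t], continuous g}.
  by apply: derivable_within_continuous => x /dg[].
have [x xt E] := MVT_segment (ltW t0) dg' cg.
by move: E; rewrite /g scale0r addr0 subr0 mulrC; exists x.
Qed.

(* The left-hand side is symmetric in [v] and [w], whence the symmetry of second
   derivatives. *)
Lemma second_difference F z v w t : 0 < t ->
  (forall x x', x \in `[0, t] -> x' \in `[0, t] ->
     derivable F (z + (x *: v + x' *: w)) v /\
     derivable ('D_v F) (z + (x *: v + x' *: w)) w) ->
  exists x x', [/\ x \in `[0, t], x' \in `[0, t] &
    F (z + t *: v + t *: w) - F (z + t *: v) - (F (z + t *: w) - F z) =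
    t ^+ 2 * 'D_w ('D_v F) (z + (x *: v + x' *: w))].
Proof.
move=> t0 d.
have I0 : 0 \in `[0, t] by rewrite bound_itvE ltW.
have It : t \in `[0, t] by rewrite bound_itvE ltW.
(* The second difference is the increment of [G] along [t *: v]. The mean value theorem is used
   twice: for [G] along [v], then for ['D_v F] along [w]. *)
pose G y := F (y + t *: w) - F y.
have dG x : x \in `[0, t] -> is_derive (z + x *: v) v G
    ('D_v F (z + x *: v + t *: w) - 'D_v F (z + x *: v)).
  move=> xt; have [d1 _] := d _ _ xt It; have [d0 _] := d _ _ xt I0.
  rewrite scale0r addr0 in d0; rewrite addrA in d1.
  exact: is_deriveB (derivable_comp_shift d1) (derivableP d0).
have [x xt E] := @MVT_line G z v t t0
  (fun x xt => @ex_derive _ _ _ _ _ _ _ (dG x xt)).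
have [|x' xt' E'] := @MVT_line ('D_v F) (z + x *: v) w t t0.
  by move=> x' xt'; rewrite -addrA; exact: (d x x' xt xt').2.
have [_ dGE] := dG x xt; rewrite dGE E' in E.
exists x, x'; split=> [//|//|]; rewrite (addrA z); apply: etrans E _.
by rewrite mulrA.
Qed.

(** Each mixed derivative, at some point of the parallelogram spanned at [z] by [t *: v] and
    [t *: w], equals the same second difference divided by [t ^+ 2]. Continuity at [z] then bounds
    the gap between the two values at [z] by any [e > 0]. *)
Lemma schwarz (D : set V) F z v w : open D -> D z ->
  (forall y, D y -> [/\ derivable F y v, derivable F y w,
     derivable ('D_v F) y w & derivable ('D_w F) y v]) ->
  {for z, continuous ('D_w ('D_v F))} -> {for z, continuous ('D_v ('D_w F))} ->
  'D_w ('D_v F) z = 'D_v ('D_w F) z.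
Proof.
move=> Do Dz d cvw cwv.
apply/eqP; rewrite -subr_eq0 -normr_le0; apply/ler_addgt0Pr => e e0.
rewrite add0r.
have : \forall y \near z, D y /\
    `|'D_w ('D_v F) z - 'D_w ('D_v F) y| < e / 2 /\
    `|'D_v ('D_w F) z - 'D_v ('D_w F) y| < e / 2.
  apply: filterI; first exact: open_nbhs_nbhs.
  have e2 : 0 < e / 2 by rewrite divr_gt0.
  apply: filterI; first exact: (cvgrPdist_lt _ _).1 cvw _ e2.
  exact: (cvgrPdist_lt _ _).1 cwv _ e2.
move=> /nbhs_ballP[r /= r0 B].
(* This size keeps the parallelogram inside the ball of radius [r]; the summand 1 keeps the
   denominator positive even if [v] and [w] vanish. *)
pose t := r / (1 + (`|v| + `|w|)).
have N0 : 0 < 1 + (`|v| + `|w|) by rewrite ltr_pwDl// addr_ge0.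
have t0 : 0 < t by rewrite divr_gt0.
have B' x x' : x \in `[0, t] -> x' \in `[0, t] ->
    ball z r (z + (x *: v + x' *: w)).
  rewrite !in_itv /= => /andP[x0 xt] /andP[x'0 x't].
  rewrite -ball_normE /= opprD addrA subrr add0r normrN.
  apply: (@le_lt_trans _ _ (t * (`|v| + `|w|))).
    rewrite (le_trans (ler_normD _ _))// !normrZ mulrDr lerD// ler_wpM2r//.
      by rewrite ger0_norm.
    by rewrite ger0_norm.
  by rewrite /t mulrAC ltr_pdivrMr// ltr_pM2l// ltrDr.
have [x1 [x2 [x1t x2t E1]]] : exists x x', [/\ x \in `[0, t], x' \in `[0, t] &
    F (z + t *: v + t *: w) - F (z + t *: v) - (F (z + t *: w) - F z) =
    t ^+ 2 * 'D_w ('D_v F) (z + (x *: v + x' *: w))].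
  apply: second_difference t0 _ => x x' xt xt'.
  have [/d[d1 _ d2 _] _] := B _ (B' _ _ xt xt').
  exact: (conj d1 d2).
have [y1 [y2 [y1t y2t E2]]] : exists x x', [/\ x \in `[0, t], x' \in `[0, t] &
    F (z + t *: w + t *: v) - F (z + t *: w) - (F (z + t *: v) - F z) =
    t ^+ 2 * 'D_v ('D_w F) (z + (x *: w + x' *: v))].
  apply: second_difference t0 _ => x x' xt xt'.
  rewrite (addrC (x *: w)).
  have [/d[_ d1 _ d2] _] := B _ (B' _ _ xt' xt).
  exact: (conj d1 d2).
have t2 : t ^+ 2 != 0 by rewrite expf_neq0// gt_eqF.
rewrite (addrC (y1 *: w)) in E2.
(* Swapping [v] and [w] only permutes the terms of the second difference. *)
have E : 'D_w ('D_v F) (z + (x1 *: v + x2 *: w)) =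
         'D_v ('D_w F) (z + (y2 *: v + y1 *: w)).
  apply: (mulfI t2); apply: etrans (esym E1) (etrans _ E2).
  rewrite (addrAC z (t *: w)) !opprB !addrA.
  by rewrite [LHS]addrAC [RHS]addrAC; congr (_ + _); rewrite [LHS]addrAC.
have [_ [P _]] := B _ (B' _ _ x1t x2t); have [_ [_ Q]] := B _ (B' _ _ y2t y1t).
move: P Q; rewrite E => P Q.
apply: le_trans (ler_distD _ _ _) _; rewrite (splitr e).
by apply: lerD; apply: ltW; [exact: P|rewrite distrC; exact: Q].
Qed.

End schwarz.

(** * Gradients on phase space *)

Section dot_facts.
Context {R : realType} {n : nat}.
Implicit Types u v w : 'rV[R]_n.

Lemma dotC u v : dot u v = dot v u.
Proof. by apply: eq_bigr => k _; rewrite mulrC. Qed.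

Lemma dotDl u v w : dot (u + v) w = dot u w + dot v w.
Proof. by rewrite -big_split; apply: eq_bigr => k _; rewrite mxE mulrDl. Qed.

Lemma dotZl k u v : dot (k *: u) v = k * dot u v.
Proof. by rewrite /dot mulr_sumr; apply: eq_bigr => i _; rewrite mxE mulrA. Qed.

Lemma dotNl u v : dot (- u) v = - dot u v.
Proof. by rewrite -scaleN1r dotZl mulN1r. Qed.

Lemma dot0l v : dot 0 v = 0.
Proof. by rewrite -(scale0r 0) dotZl mul0r. Qed.

Lemma dot_suml (I : Type) (r : seq I) (f : I -> 'rV[R]_n) v :
  dot (\sum_(i <- r) f i) v = \sum_(i <- r) dot (f i) v.
Proof.
elim: r => [|i r IH]; first by rewrite !big_nil dot0l.
by rewrite !big_cons dotDl IH.
Qed.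

Lemma dotDr u v w : dot u (v + w) = dot u v + dot u w.
Proof. by rewrite !(dotC u) dotDl. Qed.

Lemma dotZr k u v : dot u (k *: v) = k * dot u v.
Proof. by rewrite !(dotC u) dotZl. Qed.

Lemma dot0r u : dot u 0 = 0.
Proof. by rewrite dotC dot0l. Qed.

Lemma dot_sumr (I : Type) (r : seq I) (f : I -> 'rV[R]_n) u :
  dot u (\sum_(i <- r) f i) = \sum_(i <- r) dot u (f i).
Proof. by rewrite dotC dot_suml; apply: eq_bigr => i _; rewrite dotC. Qed.

Lemma dot_lincombl (s : nat) (f : 'I_s -> R) (L : 'I_s -> 'rV[R]_n) v :
  dot (\sum_i f i *: L i) v = \sum_i f i * dot (L i) v.
Proof. by rewrite dot_suml; apply: eq_bigr => i _; rewrite dotZl. Qed.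

Lemma dot_lincombr (s : nat) (f : 'I_s -> R) (L : 'I_s -> 'rV[R]_n) v :
  dot v (\sum_i f i *: L i) = \sum_i f i * dot v (L i).
Proof. by rewrite dot_sumr; apply: eq_bigr => i _; rewrite dotZr. Qed.

Lemma dot_delta u k : dot u (delta_mx 0 k) = u 0 k.
Proof.
rewrite /dot (bigD1 k) //= mxE !eqxx mulr1 big1 ?addr0// => i ik.
by rewrite mxE (negbTE ik) andbF mulr0.
Qed.

Lemma dot_nondegenerate u : (forall v, dot u v = 0) -> u = 0.
Proof.
by move=> u0; apply/rowP => k; rewrite mxE -dot_delta u0.
Qed.

End dot_facts.

Section gradient.
Context {R : realType} {n : nat}.
Implicit Types (F : 'rV[R]_n * 'rV[R]_n -> R) (x y : 'rV[R]_n).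

(** Moving along [(delta_mx 0 k, 0)] leaves [y] fixed, so the quotients agree. Partial gradients
    become directional derivatives on the product, the form in which [C2_on] and [schwarz] are
    stated. *)
Lemma grad1E F x y k : grad1 F x y 0 k = 'D_(delta_mx 0 k, 0) F (x, y).
Proof.
rewrite mxE /derive; set f := (X in X @ _); set g := (X in _ = lim (X @ _)).
suff -> : f = g by [].
apply/funext => t; rewrite /f /g /=.
by congr (_ *: (F (_, _) - _)); rewrite /= scaler0 add0r.
Qed.

Lemma grad2E F x y k : grad2 F x y 0 k = 'D_(0, delta_mx 0 k) F (x, y).
Proof.
rewrite mxE /derive; set f := (X in X @ _); set g := (X in _ = lim (X @ _)).
suff -> : f = g by [].
apply/funext => t; rewrite /f /g /=.
by congr (_ *: (F (_, _) - _)); rewrite /= scaler0 add0r.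
Qed.

Lemma pair_sum_delta (w : 'rV[R]_n * 'rV[R]_n) :
  w = \sum_k w.1 0 k *: (delta_mx 0 k, 0 : 'rV[R]_n)
    + \sum_k w.2 0 k *: (0 : 'rV[R]_n, delta_mx 0 k).
Proof.
case: w => u v /=.
have lin1 : linear (fun a : 'rV[R]_n => (a, 0 : 'rV[R]_n)).
  by move=> k a b; congr pair; rewrite /= scaler0 addr0.
have lin2 : linear (fun a : 'rV[R]_n => (0 : 'rV[R]_n, a)).
  by move=> k a b; congr pair; rewrite /= scaler0 addr0.
pose l1 := GRing.isLinear.Build _ _ _ _ _ lin1.
pose L1 : {linear _ -> _} := HB.pack (fun a : 'rV[R]_n => (a, 0 : 'rV[R]_n)) l1.
pose l2 := GRing.isLinear.Build _ _ _ _ _ lin2.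
pose L2 : {linear _ -> _} := HB.pack (fun a : 'rV[R]_n => (0 : 'rV[R]_n, a)) l2.
have E1 : L1 u = \sum_k u 0 k *: (delta_mx 0 k, 0 : 'rV[R]_n).
  by rewrite [in LHS](row_sum_delta u) linear_sum;
     apply: eq_bigr => k _; rewrite linearZ.
have E2 : L2 v = \sum_k v 0 k *: (0 : 'rV[R]_n, delta_mx 0 k).
  by rewrite [in LHS](row_sum_delta v) linear_sum;
     apply: eq_bigr => k _; rewrite linearZ.
by rewrite -E1 -E2; congr pair; rewrite /= ?addr0 ?add0r.
Qed.

Lemma diff_pair_sum F x y w :
  differentiable F (x, y) ->
  'd F (x, y) w = \sum_k 'D_(delta_mx 0 k, 0) F (x, y) * w.1 0 k
               + \sum_k 'D_(0, delta_mx 0 k) F (x, y) * w.2 0 k.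
Proof.
move=> dF; rewrite [in LHS](pair_sum_delta w) linearD !linear_sum /=.
congr (_ + _); apply: eq_bigr => k _; rewrite linearZ deriveE//;
exact: mulrC.
Qed.

Lemma diff_grad F x y w : differentiable F (x, y) ->
  'd F (x, y) w = dot (grad1 F x y) w.1 + dot (grad2 F x y) w.2.
Proof.
move=> dF; rewrite diff_pair_sum//; congr (_ + _); apply: eq_bigr => k _.
  by rewrite grad1E.
by rewrite grad2E.
Qed.

End gradient.

(** * Differentials of the gradients and symmetry of the Hessian *)

Section hessian.
Context {R : realType} {n : nat}.
Variables (D : set ('rV[R]_n * 'rV[R]_n)) (F : 'rV[R]_n * 'rV[R]_n -> R).
Hypotheses (D_open : open D) (F_C2 : C2_on D F).

Lemma C2_hessian_sym z v w : D z -> 'D_w ('D_v F) z = 'D_v ('D_w F) z.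
Proof.
move=> Dz; apply: (schwarz D_open Dz).
- move=> y /F_C2[dF dDF].
  by split; apply: diff_derivable => //; case: (dDF v) (dDF w) => dv _ [dw _].
- by have [_ /(_ v)[]] := F_C2 Dz.
- by have [_ /(_ w)[]] := F_C2 Dz.
Qed.

(** [L] and [K] are the two blocks of the Hessian of [F] applied to [(dQ u, dP u)]. Pairing them
    with [(dQ v, dP v)] gives the second derivative of [F] in both directions, so the last clause is
    the symmetry of the Hessian. *)
Lemma is_diff_gradients (V : normedModType R)
    (Q P dQ dP : V -> 'rV[R]_n) z :
  is_diff z Q dQ -> is_diff z P dP -> D (Q z, P z) ->
  exists L K : V -> 'rV[R]_n,
  [/\ is_diff z (fun y => grad1 F (Q y) (P y)) L,
      is_diff z (fun y => grad2 F (Q y) (P y)) K &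
      forall u v, dot (L u) (dQ v) + dot (K u) (dP v) =
                  dot (L v) (dQ u) + dot (K v) (dP u)].
Proof.
move=> dQz dPz Dz.
have dG : is_diff z (fun y => (Q y, P y)) (fun u => (dQ u, dP u)).
  exact: is_diff_pair.
have dDF v : is_diff z ('D_v F \o (fun y => (Q y, P y)))
    (fun u => 'D_(dQ u, dP u) ('D_v F) (Q z, P z)).
  have [_ /(_ v)[dv _]] := F_C2 Dz.
  have dv' : is_diff (Q z, P z) ('D_v F) ('d ('D_v F) (Q z, P z)) by [].
  apply: (is_diff_eq (is_diff_comp dG dv')).
  by apply/funext => u /=; rewrite deriveE.
pose L u : 'rV[R]_n :=
  \row_k 'D_(dQ u, dP u) ('D_(delta_mx 0 k, 0) F) (Q z, P z).
pose K u : 'rV[R]_n :=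
  \row_k 'D_(dQ u, dP u) ('D_(0, delta_mx 0 k) F) (Q z, P z).
have LK u v : dot (L u) (dQ v) + dot (K u) (dP v) =
    'D_(dQ v, dP v) ('D_(dQ u, dP u) F) (Q z, P z).
  have [_ /(_ (dQ u, dP u))[dv _]] := F_C2 Dz.
  rewrite deriveE// diff_pair_sum//; congr (_ + _); apply: eq_bigr => k _;
    by rewrite mxE C2_hessian_sym.
exists L, K; split => [||u v]; last by rewrite !LK C2_hessian_sym.
- apply: is_diff_mx => i k; rewrite (ord1 i).
  apply: is_diff_eq.
    have -> : (fun y => grad1 F (Q y) (P y) 0 k) =
      'D_(delta_mx 0 k, 0) F \o (fun y => (Q y, P y)).
      by apply/funext => y; rewrite grad1E.
    exact: dDF.
  by apply/funext => u; rewrite mxE.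
- apply: is_diff_mx => i k; rewrite (ord1 i).
  apply: is_diff_eq.
    have -> : (fun y => grad2 F (Q y) (P y) 0 k) =
      'D_(0, delta_mx 0 k) F \o (fun y => (Q y, P y)).
      by apply/funext => y; rewrite grad2E.
    exact: dDF.
  by apply/funext => u; rewrite mxE.
Qed.

End hessian.

(** * Nodal basis and Runge-Kutta form *)

Section change_of_basis.
Context {R : realType} {s : nat}.
Variables (psi : 'I_s -> R -> R) (c : 'I_s -> R).

Lemma integral_to_lincomb (m : 'I_s -> R) t :
  (forall i,
     (@lebesgue_measure R).-integrable `[0, 1] (fun x => (psi i x)%:E)) ->
  t \in `[0, 1] ->
  integral_to t (fun x => \sum_k m k * psi k x) =
  \sum_k m k * integral_to t (psi k).
Proof.
move=> psi_int; rewrite in_itv /= => /andP[t0 t1].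
have mt : measurable (`[0, t]%classic : set (measurableTypeR R)).
  exact: measurable_itv.
have psit k : (@lebesgue_measure R).-integrable `[0, t] (EFin \o psi k).
  apply: integrableS (psi_int k) => // x /=.
  by rewrite !in_itv /= => /andP[-> /le_trans->].
have mpsit k :
    (@lebesgue_measure R).-integrable `[0, t] (EFin \o (fun x => m k * psi k x)).
  have -> : EFin \o (fun x => m k * psi k x) =
    (fun x => (m k)%:E * (EFin \o psi k) x)%E by apply/funext => x /=.
  exact: integrableZl.
rewrite /integral_to; elim: (index_enum _) => [|k r IH].
  rewrite big_nil; under eq_Rintegral do rewrite big_nil.
  by rewrite Rintegral_cst// mul0r.
rewrite big_cons -IH; under eq_Rintegral do rewrite big_cons.
rewrite RintegralD//; first by rewrite RintegralZl.
have -> : EFin \o (fun x => \sum_(j <- r) m j * psi j x) =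
    (fun x => \sum_(j <- r) (EFin \o (fun x => (m j * psi j x)%R)) x)%E.
  by apply/funext => x /=; rewrite sumEFin.
exact: integrable_sum.
Qed.

Hypothesis M_inv : control_matrix psi c \in unitmx.

Lemma nodal_basis_delta i j : nodal_basis psi c i (c j) = (i == j)%:R.
Proof.
transitivity ((invmx (control_matrix psi c) *m control_matrix psi c) i j).
  by rewrite mxE; apply: eq_bigr => k _; rewrite mxE.
by rewrite mulVmx// mxE.
Qed.

Hypothesis psi_int : forall i,
  (@lebesgue_measure R).-integrable `[0, 1] (fun x => (psi i x)%:E).

(** Integrated form of [psi = M phi]: by linearity the integrals of the nodal basis are [M^-1] times
    those of [psi], and multiplying by [M] recovers the latter. *)
Lemma integral_to_basis t j : t \in `[0, 1] ->
  integral_to t (psi j) =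
  \sum_k psi j (c k) * integral_to t (nodal_basis psi c k).
Proof.
move=> t01.
pose F : 'cV[R]_s := \col_k integral_to t (psi k).
have FE k : integral_to t (nodal_basis psi c k) =
    (invmx (control_matrix psi c) *m F) k 0.
  rewrite /nodal_basis (integral_to_lincomb _ psi_int t01) mxE.
  by apply: eq_bigr => i _; rewrite mxE.
transitivity ((control_matrix psi c *m (invmx (control_matrix psi c) *m F)) j 0).
  by rewrite mulKVmx// mxE.
by rewrite mxE; apply: eq_bigr => k _; rewrite mxE -FE.
Qed.

(** Both sides integrate the same velocity over [[0, t]]; in the nodal basis its coefficients are
    its values at the control points. *)
Lemma integral_to_velocity n (V : 'M[R]_(s, n)) t : t \in `[0, 1] ->
  \sum_j integral_to t (psi j) *: row j V =
  \sum_k integral_to t (nodal_basis psi c k)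
         *: \sum_i psi i (c k) *: row i V.
Proof.
move=> t01.
under eq_bigr do rewrite (integral_to_basis _ t01) scaler_suml.
rewrite exchange_big; apply: eq_bigr => k _ /=.
by rewrite scaler_sumr; apply: eq_bigr => i _; rewrite scalerA mulrC.
Qed.

(** Interpolation: the conditions read [M^T V = W], solved by inverting [M^T]. *)
Lemma nodal_velocity_exists n (W : 'I_s -> 'rV[R]_n) :
  exists V : 'M[R]_(s, n),
    forall k, \sum_i psi i (c k) *: row i V = W k.
Proof.
exists (invmx (control_matrix psi c)^T *m \matrix_k W k) => k.
have -> : W k = row k ((control_matrix psi c)^T *m
    (invmx (control_matrix psi c)^T *m \matrix_k W k)).
  by rewrite mulKVmx ?unitmx_tr// rowK.
rewrite row_mul mulmx_sum_row; apply: eq_bigr => i _.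
by rewrite !mxE.
Qed.

End change_of_basis.

(** * Equivalence of the Galerkin system and the partitioned Runge-Kutta system *)

Section equivalence.
Context {R : realType} {n s : nat}.
Variables (psi : 'I_s -> R -> R) (c : 'I_s -> R).
Variables (H : 'rV[R]_n * 'rV[R]_n -> R) (h : R).
Hypothesis psi_int : forall i,
  (@lebesgue_measure R).-integrable `[0, 1] (fun x => (psi i x)%:E).
Hypothesis c_in : forall i, c i \in `[0, 1].
Hypothesis M_inv : control_matrix psi c \in unitmx.
Let phi := nodal_basis psi c.
Let b := full_coef phi.
Let a := stage_coef phi c.
Hypothesis b_neq0 : forall i, b i != 0.

Let one_in : 1 \in `[0, 1 : R]. Proof. by rewrite in_itv /= ler01 lexx. Qed.

(** The Galerkin residuals are the rows of [M T], where [T] collects the Runge-Kutta momentum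
    residuals weighted by [b k]. Since [M] is invertible and each [b k] is nonzero, one family
    vanishes exactly when the other does. *)
Lemma momentum_equations p0 (P : 'M[R]_(s, n)) (L : 'I_s -> 'rV[R]_n) :
  (forall j, 0 =
        \sum_(i < s) (b i * psi j (c i)) *: row i P
        - full_coef psi j *: p0
        + h *: \sum_(i < s)
            (b i * full_coef psi j - b i * stage_coef psi c i j) *: L i) <->
  (forall i, row i P = p0 - h *: \sum_(j < s) conj_coef b a i j *: L j).
Proof.
pose T : 'M[R]_(s, n) := \matrix_k
  (b k *: (row k P - (p0 - h *: \sum_(j < s) conj_coef b a k j *: L j))).
(* The weight [b k] clears the denominator of [conj_coef]. *)
have TE k : row k T = b k *: row k P - b k *: p0
    + h *: \sum_(i < s) (b i * b k - b i * a i k) *: L i.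
  rewrite rowK scalerBr scalerBr opprB addrCA addrC; congr (_ - _ + _).
  rewrite scalerA mulrC -scalerA scaler_sumr; congr (_ *: _).
  apply: eq_bigr => i _; rewrite scalerA /conj_coef mulrC divfK//.
  by rewrite (mulrC (b k)).
have SE j : \sum_(i < s) (b i * psi j (c i)) *: row i P
        - full_coef psi j *: p0
        + h *: \sum_(i < s)
            (b i * full_coef psi j - b i * stage_coef psi c i j) *: L i =
   row j (control_matrix psi c *m T).
  rewrite row_mul mulmx_sum_row.
  under [RHS]eq_bigr do rewrite TE !mxE scalerDr scalerBr !scalerA.
  rewrite big_split sumrB /=; congr (_ - _ + _).
  - by apply: eq_bigr => k _; rewrite mulrC.
  - by rewrite -scaler_suml; congr (_ *: _); exact: integral_to_basis.
  - under [RHS]eq_bigr do rewrite mulrC -scalerA scaler_sumr.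
    rewrite -scaler_sumr exchange_big; congr (_ *: _); apply: eq_bigr => i _ /=.
    under [RHS]eq_bigr do rewrite scalerA.
    rewrite -scaler_suml; congr (_ *: _).
    rewrite /full_coef /stage_coef !(integral_to_basis M_inv psi_int j)//.
    by rewrite !mulr_sumr -sumrB; apply: eq_bigr => k _;
       rewrite mulrBr !(mulrCA _ (b i)).
split=> [S0 k|PE j].
  have T0 : T = 0.
    rewrite -[T](mulKmx M_inv) (_ : control_matrix psi c *m T = 0) ?mulmx0//.
    by apply/row_matrixP => j; rewrite -SE -S0 row0.
  have /eqP := congr1 (row k) T0.
  by rewrite rowK row0 scaler_eq0 (negbTE (b_neq0 k)) /= subr_eq0 => /eqP.
rewrite SE (_ : T = 0) ?mulmx0 ?row0//.
by apply/row_matrixP => k; rewrite rowK PE subrr scaler0 row0.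
Qed.

(** The last Galerkin equation says that the velocity at [c j] is the momentum gradient of [H] at
    stage [j]. This eliminates [V]; conversely, [V] is recovered by interpolating these
    gradients. *)
Lemma galerkin_prk_equiv q0 p0 q1 p1 (Q P : 'M[R]_(s, n)) :
  (exists V : 'M[R]_(s, n), galerkin_system psi c b H h q0 p0 q1 p1 Q P V) <->
  prk_system b a (conj_coef b a) H h q0 p0 q1 p1 Q P.
Proof.
(* Taken at [t = 1] this gives the update of [q], and at [t = c i] the position stages. *)
have velocity (V : 'M[R]_(s, n)) t :
    (forall j, 0 = \sum_i psi i (c j) *: row i V
                   - grad2 H (row j Q) (row j P)) ->
    t \in `[0, 1] ->
    \sum_j integral_to t (psi j) *: row j V =
    \sum_k integral_to t (phi k) *: grad2 H (row k Q) (row k P).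
  move=> E5 t01; rewrite (integral_to_velocity M_inv psi_int)//.
  by apply: eq_bigr => k _; have /esym/eqP := E5 k; rewrite subr_eq0 => /eqP ->.
split=> [[V [E1 E2 E3 E4 E5]]|[E1 E2 E3 E4]].
  split; [|exact: E2| |exact/momentum_equations].
  - by rewrite E1; congr (_ + _ *: _); exact: velocity V 1 E5 one_in.
  - by move=> i; rewrite E3; congr (_ + _ *: _);
    exact: velocity V (c i) E5 (c_in i).
have [V VE] := nodal_velocity_exists M_inv
  (fun k => grad2 H (row k Q) (row k P)).
have E5 j : 0 = \sum_i psi i (c j) *: row i V - grad2 H (row j Q) (row j P).
  by rewrite VE subrr.
exists V; split; [|exact: E2| | |exact: E5].
- rewrite E1; congr (_ + _ *: _); exact: esym (velocity V 1 E5 one_in).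
- move=> i; rewrite E3; congr (_ + _ *: _);
  exact: esym (velocity V (c i) E5 (c_in i)).
- exact/(momentum_equations _ _ (fun i => grad1 H (row i Q) (row i P))).
Qed.
End equivalence.

(** * The discrete right Hamiltonian *)

Section discrete_hamiltonian.
Context {R : realType} {n s : nat}.
Variables (psi : 'I_s -> R -> R) (c b : 'I_s -> R).
Variables (U : set 'rV[R]_n) (H : 'rV[R]_n * 'rV[R]_n -> R) (h : R).
Hypothesis h_neq0 : h != 0.
Hypothesis b_neq0 : forall i, b i != 0.
Hypothesis H_diff : forall z, U z.1 -> differentiable H z.

Let phase := ('rV[R]_n * 'rV[R]_n)%type.
Let stages := ('M[R]_(s, n) * 'M[R]_(s, n))%type.

(** All variables are kept together so that a single differential yields both stationarity in the
    stages and the gradient of the discrete Hamiltonian. *)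
Let joint_action (w : phase * stages) : R :=
  galerkin_action psi c b H h w.1.1 w.1.2 w.2.

Let L (x : phase * stages) i : 'rV[R]_n :=
  grad1 H (row i (galerkin_stages psi c h x.1.1 x.2.1)) (row i x.2.2).

Let K (x : phase * stages) i : 'rV[R]_n :=
  grad2 H (row i (galerkin_stages psi c h x.1.1 x.2.1)) (row i x.2.2).

(** Stationarity residuals: the derivative of the action in the [j]-th row of [V] is
    [h *: Vres x j], and in the [i]-th row of [P] it is [- (h * b i) *: Pres x i]. *)
Let Vres (x : phase * stages) j : 'rV[R]_n :=
  full_coef psi j *: x.1.2 - \sum_i (b i * psi j (c i)) *: row i x.2.2
  + h *: \sum_i (b i * stage_coef psi c i j) *: L x i.

Let Pres (x : phase * stages) i : 'rV[R]_n :=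
  \sum_j psi j (c i) *: row j x.2.1 - K x i.

Let daction (x w : phase * stages) : R :=
  dot (x.1.2 + h *: \sum_i b i *: L x i) w.1.1
  + dot w.1.2 (x.1.1 + h *: \sum_i full_coef psi i *: row i x.2.1)
  + h * \sum_j dot (Vres x j) (row j w.2.1)
  - h * \sum_i b i * dot (Pres x i) (row i w.2.2).

Lemma is_diff_action x :
  (forall i, U (row i (galerkin_stages psi c h x.1.1 x.2.1))) ->
  is_diff x joint_action (daction x).
Proof.
move=> UQ.
have dx : is_diff x id id by exact: is_diff_id.
have d1 := is_diff_fst dx; have d2 := is_diff_snd dx.
have dq := is_diff_fst d1; have dp := is_diff_snd d1.
have dV := is_diff_fst d2; have dP := is_diff_snd d2.
have dVs (f : 'I_s -> R) : is_diff x
    (fun w : phase * stages => \sum_j f j *: row j w.2.1)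
    (fun w : phase * stages => \sum_j f j *: row j w.2.1).
  by apply: is_diff_sum => j; apply: is_diff_scale; apply: is_diff_row dV.
have dPi i := is_diff_row i dP.
have dQi i : is_diff x
   (fun w : phase * stages => row i (galerkin_stages psi c h w.1.1 w.2.1))
   (fun w : phase * stages =>
      w.1.1 + h *: \sum_j stage_coef psi c i j *: row j w.2.1).
  under eq_fun do rewrite rowK.
  exact: is_diff_add dq (is_diff_scale h (dVs _)).
have dH i := is_diff_comp (is_diff_pair (dQi i) (dPi i))
  (differentiableP (H_diff (z := (_, row i x.2.2)) (UQ i))).
have dterm i := is_diff_scale (b i)
  (is_diff_sub (is_diff_dot (dPi i) (dVs (fun j => psi j (c i)))) (dH i)).
have dsum := is_diff_scale h (is_diff_sum (index_enum _) dterm).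
have dA := is_diff_sub
  (is_diff_dot dp (is_diff_add dq (is_diff_scale h (dVs (full_coef psi))))) dsum.
have -> : joint_action = fun w =>
       dot w.1.2 (w.1.1 + h *: \sum_j full_coef psi j *: row j w.2.1) -
       h *: \sum_i b i *:
          (dot (row i w.2.2) (\sum_j psi j (c i) *: row j w.2.1) -
           (H \o (fun y : phase * stages =>
              (row i (galerkin_stages psi c h y.1.1 y.2.1),
               row i y.2.2))) w).
  by apply/funext => -[[? ?] [? ?]].
apply: (is_diff_eq dA); apply/funext => w; rewrite /daction /=.
have scaleE (k r : R) : k *: r = k * r by [].
(* The contributions of the stages are sorted by the variation they multiply; the double sums are
   put in the order that matches [Vres]. *)
have -> : \sum_i b i *: (dot (row i w.2.2) (\sum_j psi j (c i) *: row j x.2.1) +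
     dot (row i x.2.2) (\sum_j psi j (c i) *: row j w.2.1) -
     'd H (row i (galerkin_stages psi c h x.1.1 x.2.1), row i x.2.2)
       (w.1.1 + h *: \sum_j stage_coef psi c i j *: row j w.2.1, row i w.2.2)) =
   \sum_i b i * dot (Pres x i) (row i w.2.2)
   + \sum_j \sum_i b i * psi j (c i) * dot (row i x.2.2) (row j w.2.1)
   - \sum_i b i * dot (L x i) w.1.1
   - h * \sum_j \sum_i b i * stage_coef psi c i j * dot (L x i) (row j w.2.1).
  rewrite [X in _ + X - _ - _]exchange_big [X in _ - h * X]exchange_big /=.
  rewrite mulr_sumr -big_split -!sumrB; apply: eq_bigr => i _ /=.
  rewrite diff_grad; last by apply: H_diff; exact: UQ.
  rewrite -/(L x i) -/(K x i) /= (dotC (row i w.2.2)) dotDr dotZr !dot_lincombr.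
  under [X in _ + X - _ - _]eq_bigr do rewrite -mulrA.
  under [X in _ - h * X]eq_bigr do rewrite -mulrA.
  rewrite -!mulr_sumr [dot (Pres x i) _]dotDl dotNl.
  rewrite scaleE; ring.
have -> : \sum_j dot (Vres x j) (row j w.2.1) =
   \sum_j full_coef psi j * dot x.1.2 (row j w.2.1)
   - \sum_j \sum_i b i * psi j (c i) * dot (row i x.2.2) (row j w.2.1)
   + h * \sum_j \sum_i b i * stage_coef psi c i j * dot (L x i) (row j w.2.1).
  rewrite mulr_sumr -sumrB -big_split; apply: eq_bigr => j _ /=.
  by rewrite /Vres !dotDl dotNl !dotZl !dot_lincombl.
rewrite !dotDr dotDl !(dotZl, dotZr) dot_lincombl !dot_lincombr.
rewrite scaleE; ring.
Qed.

(** Test matrices with a single nonzero row isolate each [F k]. *)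
Lemma dot_rows_nondegenerate (F : 'I_s -> 'rV[R]_n) :
  (forall M : 'M[R]_(s, n), \sum_k dot (F k) (row k M) = 0) ->
  forall k, F k = 0.
Proof.
move=> F0 k; apply: dot_nondegenerate => v.
rewrite -[RHS](F0 (\matrix_i ((i == k)%:R *: v))) (bigD1 k)//= rowK eqxx scale1r.
rewrite big1 ?addr0// => i ik.
by rewrite rowK (negbTE ik) scale0r dot0r.
Qed.

Lemma critical_action x :
  (forall i, U (row i (galerkin_stages psi c h x.1.1 x.2.1))) ->
  critical_point (galerkin_action psi c b H h x.1.1 x.1.2) x.2 ->
  (forall j, Vres x j = 0) /\ (forall i, Pres x i = 0).
Proof.
move=> UQ [_ crit].
(* Freezing [(q0, p1)] amounts to giving it zero variation in [daction]. *)
have dact : is_diff (x.2) (joint_action \o (fun Y => (x.1, Y)))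
    (daction x \o (fun v => (0, v))).
  have dx : is_diff (x.2) (fun Y : stages => (x.1, Y)) (fun v => (0, v)).
    exact: (is_diff_pair (is_diff_cst x.1 x.2) (is_diff_id x.2)).
  have dA : is_diff ((fun Y : stages => (x.1, Y)) x.2) joint_action (daction x).
    by rewrite -surjective_pairing; exact: is_diff_action.
  exact: is_diff_comp dx dA.
have d0 V P : h * \sum_j dot (Vres x j) (row j V)
              - h * \sum_i b i * dot (Pres x i) (row i P) = 0.
  apply: etrans (crit (V, P)); rewrite (_ : galerkin_action _ _ _ _ _ _ _ =
    joint_action \o (fun Y => (x.1, Y)))//.
  rewrite (@diff_val _ _ _ _ _ _ _ dact) /= /daction /=.
  by rewrite dot0r dot0l !add0r.
split; apply: dot_rows_nondegenerate => M.
  have := d0 M 0; rewrite [X in _ - _ * X]big1 ?mulr0 ?subr0.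
    by move=> /eqP; rewrite mulf_eq0 (negbTE h_neq0) => /eqP.
  by move=> i _; rewrite row0 dot0r mulr0.
(* Dividing the rows of the test variation by [b i] absorbs the quadrature weights. *)
have := d0 0 (\matrix_i ((b i)^-1 *: row i M)).
rewrite [X in _ * X - _]big1 ?mulr0 ?sub0r; last first.
  by move=> i _; rewrite row0 dot0r.
move=> /eqP; rewrite oppr_eq0 mulf_eq0 (negbTE h_neq0) => /eqP e0.
apply: etrans e0; apply: eq_bigr => i _; rewrite rowK dotZr mulVKf// b_neq0.
Qed.

Variables (E : set phase) (X : phase -> stages).
Hypothesis branch : stationary_branch psi c b U H h E X.
Let Hd := discrete_right_hamiltonian psi c b H h X.

(** Chain rule through [y |-> (y, X y)]: the differential of [X] occurs only paired with [Vres] and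
    [Pres], which vanish on the branch. *)
Lemma is_diff_discrete_hamiltonian z : E z ->
  is_diff z Hd (fun w =>
    dot (z.2 + h *: \sum_i b i *: L (z, X z) i) w.1
    + dot w.2 (z.1 + h *: \sum_i full_coef psi i *: row i (X z).1)).
Proof.
have [_ br] := branch => Ez; have [dX UQ crit] := br _ Ez.
have [V0 P0] := critical_action (x := (z, X z)) UQ crit.
have dA : is_diff (z, X z) joint_action (daction (z, X z)).
  exact: is_diff_action.
have dG : is_diff z (fun y => (y, X y)) (fun w => (w, 'd X z w)).
  exact: is_diff_pair (is_diff_id z) (differentiableP dX).
apply: (is_diff_eq (is_diff_comp dG dA)); apply/funext => w.
rewrite /= /daction /= [X in _ + h * X - _]big1 => [|j _];
  last by rewrite V0 dot0l.
rewrite [X in _ - h * X]big1 => [|i _]; last by rewrite P0 dot0l mulr0.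
by rewrite !mulr0 addr0 subr0.
Qed.

Lemma grad_discrete_hamiltonian z : E z ->
  grad1 Hd z.1 z.2 = z.2 + h *: \sum_i b i *: L (z, X z) i /\
  grad2 Hd z.1 z.2 = z.1 + h *: \sum_i full_coef psi i *: row i (X z).1.
Proof.
move=> Ez; have dHd := is_diff_discrete_hamiltonian Ez.
split; apply/rowP => k.
  rewrite grad1E -surjective_pairing deriveE// (@diff_val _ _ _ _ _ _ _ dHd) /=.
  by rewrite dot0l addr0 dot_delta.
rewrite grad2E -surjective_pairing deriveE// (@diff_val _ _ _ _ _ _ _ dHd) /=.
by rewrite dot0r add0r dotC dot_delta.
Qed.

Lemma discrete_hamiltonian_galerkin q0 p0 q1 p1 : E (q0, p1) ->
  (p0 = grad1 Hd q0 p1 /\ q1 = grad2 Hd q0 p1) <->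
  galerkin_system psi c b H h q0 p0 q1 p1
    (galerkin_stages psi c h q0 (X (q0, p1)).1)
    (X (q0, p1)).2 (X (q0, p1)).1.
Proof.
move=> Ez; have [/= -> ->] := grad_discrete_hamiltonian Ez.
have [_ br] := branch; have [dX UQ crit] := br _ Ez.
have [V0 P0] := critical_action (x := (_, X (q0, p1))) UQ crit.
split=> [[p0E q1E]|[q1E p1E _ _ _]]; last first.
  (* The updates of [q] and [p] alone already give back both gradient equations. *)
  split=> //.
  by rewrite [X in X + _]p1E subrK.
split.
- exact: q1E.
- by rewrite p0E addrK.
- by move=> i; rewrite rowK.
(* Stationarity in [V] is written with [p1]; substituting the formula for [p0] turns the right-hand
   side into [- Vres]. *)
- move=> j; rewrite p0E.
  have -> : \sum_i (b i * full_coef psi j - b i * stage_coef psi c i j)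
       *: grad1 H (row i (galerkin_stages psi c h q0 (X (q0, p1)).1))
            (row i (X (q0, p1)).2) =
      full_coef psi j *: (\sum_i b i *: L (q0, p1, X (q0, p1)) i)
      - \sum_i (b i * stage_coef psi c i j) *: L (q0, p1, X (q0, p1)) i.
    rewrite scaler_sumr -sumrB; apply: eq_bigr => i _.
    by rewrite scalerBl scalerA mulrC.
  rewrite scalerDr !scalerBr !scalerA (mulrC _ h) opprD !addrA subrK.
  by rewrite -[LHS]oppr0 -[X in - X = _](V0 j) /Vres /= !opprD opprK (addrC (- _)).
- by move=> j; exact: esym (P0 j).
Qed.

End discrete_hamiltonian.

(** * Symplecticity *)

Section symplecticity.
Context {R : realType} {n s : nat}.
Variables (b : 'I_s -> R) (a : 'I_s -> 'I_s -> R) (h : R).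
Hypothesis b_neq0 : forall i, b i != 0.
Let at_ := conj_coef b a.

(** The symplecticity condition for partitioned Runge-Kutta coefficients. *)
Lemma conj_coefE i j : b i * at_ i j + b j * a j i = b i * b j.
Proof. by rewrite /at_ /conj_coef mulrC divfK// subrK. Qed.

(** Here [up] and [vq] are variations of the initial momentum and position, [P] and [Q] the induced
    variations of the stages, [L] and [K] those of the gradients. The terms of order [h ^+ 2] on the
    two sides agree by [conj_coefE]. *)
Lemma prk_tangent_form (up vq : 'rV[R]_n) (L K P Q : 'I_s -> 'rV[R]_n) :
  (forall i, P i = up - h *: \sum_j at_ i j *: L j) ->
  (forall i, Q i = vq + h *: \sum_j a i j *: K j) ->
  dot (up - h *: \sum_i b i *: L i) (vq + h *: \sum_i b i *: K i) =
  dot up vq + h * \sum_i b i * (dot (P i) (K i) - dot (L i) (Q i)).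
Proof.
move=> PE QE.
have PK i : dot (P i) (K i) =
    dot up (K i) - h * \sum_j at_ i j * dot (L j) (K i).
  by rewrite PE dotDl dotNl dotZl dot_lincombl.
have LQ i : dot (L i) (Q i) =
    dot (L i) vq + h * \sum_j a i j * dot (L i) (K j).
  by rewrite QE dotDr dotZr dot_lincombr.
have S1 : \sum_i b i * (dot (P i) (K i) - dot (L i) (Q i)) =
    \sum_i b i * dot up (K i) - \sum_i b i * dot (L i) vq -
    h * (\sum_i \sum_j b i * at_ i j * dot (L j) (K i) +
         \sum_i \sum_j b i * a i j * dot (L i) (K j)).
  rewrite -big_split /= mulr_sumr -!sumrB; apply: eq_bigr => i _.
  rewrite PK LQ.
  under [X in _ - h * (X + _)]eq_bigr do rewrite -mulrA.
  under [X in _ - h * (_ + X)]eq_bigr do rewrite -mulrA.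
  rewrite -!mulr_sumr; ring.
(* Renaming indices in the first double sum pairs [at_ j i] with [a i j]. *)
have S2 : \sum_i \sum_j b i * at_ i j * dot (L j) (K i) +
         \sum_i \sum_j b i * a i j * dot (L i) (K j) =
         \sum_i \sum_j b i * b j * dot (L i) (K j).
  rewrite [X in X + _]exchange_big -big_split; apply: eq_bigr => i _ /=.
  rewrite -big_split; apply: eq_bigr => j _ /=.
  by rewrite -mulrDl conj_coefE [b j * b i]mulrC.
have S3 : dot (\sum_i b i *: L i) (\sum_i b i *: K i) =
         \sum_i \sum_j b i * b j * dot (L i) (K j).
  rewrite dot_lincombl; apply: eq_bigr => i _.
  by rewrite dot_lincombr mulr_sumr; apply: eq_bigr => j _; rewrite mulrA.
rewrite S1 S2 -S3 !(dotDl, dotDr, dotNl, dotZl, dotZr).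
rewrite (dot_lincombl b L vq) (dot_lincombr b K up); ring.
Qed.

Variables (U : set 'rV[R]_n) (H : 'rV[R]_n * 'rV[R]_n -> R).
Hypotheses (U_open : open U) (H_C2 : C2_on [set z | U z.1] H).

Theorem symplectic_prk_conj_coef : symplectic_prk b a at_ U H h.
Proof.
move=> E Phi [E_open [Q [P st]]] z Ez.
have D_open : open [set w : 'rV[R]_n * 'rV[R]_n | U w.1].
  by apply: open_comp => // w _; exact: cvg_fst.
have [dQ dP UQ _] := st _ Ez.
have near_st : \forall y \near z,
    prk_system b a at_ H h y.1 y.2 (Phi y).1 (Phi y).2 (Q y) (P y).
  by apply: filterS (open_nbhs_nbhs (conj E_open Ez)) => y /st[].
have dQi i : is_diff z (fun y => row i (Q y)) (fun u => row i ('d Q z u)).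
  exact/is_diff_row/differentiableP.
have dPi i : is_diff z (fun y => row i (P y)) (fun u => row i ('d P z u)).
  exact/is_diff_row/differentiableP.
have /choice[L /choice[K LK]] := fun i =>
  is_diff_gradients D_open H_C2 (dQi i) (dPi i) (UQ i).
have dL i := let: And3 d _ _ := LK i in d.
have dK i := let: And3 _ d _ := LK i in d.
have symLK i := let: And3 _ _ e := LK i in e.
have d1 : is_diff z (fun y => y.1) (fun u => u.1).
  by apply: (@is_diff_fst _ _ _ _ id id); exact: is_diff_id.
have d2 : is_diff z (fun y => y.2) (fun u => u.2).
  by apply: (@is_diff_snd _ _ _ _ id id); exact: is_diff_id.
have dsum (c : 'I_s -> R) (f df : 'I_s -> _ -> 'rV[R]_n) :
    (forall i, is_diff z (f i) (df i)) ->
    is_diff z (fun y => h *: \sum_i c i *: f i y)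
      (fun u => h *: \sum_i c i *: df i u).
  by move=> fdf; apply/is_diff_scale/is_diff_sum => i; exact: is_diff_scale.
(* As [E] is open, the stage equations hold near [z] and can be differentiated there. *)
have QE i u : row i ('d Q z u) = u.1 + h *: \sum_j a i j *: K j u.
  apply: (near_eq_diff _ (dQi i) (is_diff_add d1 (dsum (a i) _ _ dK)) u).
  by apply: filterS near_st => y [_ _ -> _].
have PE i u : row i ('d P z u) = u.2 - h *: \sum_j at_ i j *: L j u.
  apply: (near_eq_diff _ (dPi i) (is_diff_sub d2 (dsum (at_ i) _ _ dL)) u).
  by apply: filterS near_st => y [_ _ _ ->].
have dPhi : is_diff z Phi (fun u => (u.1 + h *: \sum_i b i *: K i u,
                                     u.2 - h *: \sum_i b i *: L i u)).
  have := is_diff_pair (is_diff_add d1 (dsum b _ _ dK))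
                       (is_diff_sub d2 (dsum b _ _ dL)).
  apply: near_eq_is_diff.
  by apply: filterS near_st => y [<- <- _ _]; case: (Phi y).
split=> [|u v]; first by [].
rewrite diff_val /canonical_two_form /=.
rewrite (prk_tangent_form (L:=L^~ u) (K:=K^~ v) (PE^~ u) (QE^~ v)).
rewrite (prk_tangent_form (L:=L^~ v) (K:=K^~ u) (PE^~ v) (QE^~ u)).
(* The momentum slot uses one tangent vector and the position slot the other. After
   antisymmetrizing, the stage sums for [(u, v)] and [(v, u)] must coincide, which holds termwise by
   the symmetry of the Hessian at each stage. *)
suff -> : \sum_i b i * (dot (row i ('d P z u)) (K i v) -
                        dot (L i u) (row i ('d Q z v))) =
          \sum_i b i * (dot (row i ('d P z v)) (K i u) -
                        dot (L i v) (row i ('d Q z u))) by ring.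
apply: eq_bigr => i _; congr (_ * _).
have subr_exchange (x y x' y' : R) : x + y = x' + y' -> y' - x = y - x'.
  by move=> e; rewrite -(addKr x' y') -e addrA addrAC addrK addrC.
rewrite (dotC (row i ('d P z u))) (dotC (row i ('d P z v))).
exact: (subr_exchange _ _ _ _ (symLK i u v)).
Qed.
End symplecticity.

Unset Implicit Arguments.
Set Strict Implicit.
Set Printing Implicit Defensive.

Theorem theorem3 (R : realType) (n s : nat)
  (U : set 'rV[R]_n) (H : 'rV[R]_n * 'rV[R]_n -> R) (h : R)
  (psi : 'I_s -> R -> R) (c : 'I_s -> R)
  (U_open : open U)
  (H_C2 : C2_on [set z | U z.1] H)
  (h_gt0 : 0 < h)
  (psi_int : forall i,
     (@lebesgue_measure R).-integrable `[0, 1] (fun t => (psi i t)%:E))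
  (psi_indep : lin_indep01 psi)
  (c_in : forall i, c i \in `[0, 1])
  (M_inv : control_matrix psi c \in unitmx)
  (b_neq0 : forall i, full_coef (nodal_basis psi c) i != 0) :
  let phi := nodal_basis psi c in
  let b := full_coef phi in
  let a := stage_coef phi c in
  let at_ := conj_coef b a in
  (forall i j, phi i (c j) = (i == j)%:R) /\
  (forall E X, stationary_branch psi c b U H h E X ->
     let Hd := discrete_right_hamiltonian psi c b H h X in
     forall q0 p0 q1 p1, E (q0, p1) ->
       (p0 = grad1 Hd q0 p1 /\ q1 = grad2 Hd q0 p1) <->
       galerkin_system psi c b H h q0 p0 q1 p1
         (galerkin_stages psi c h q0 (X (q0, p1)).1)
         (X (q0, p1)).2 (X (q0, p1)).1) /\
  (forall q0 p0 q1 p1 (Q P : 'M[R]_(s, n)), (forall i, U (row i Q)) ->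
     (exists V : 'M[R]_(s, n),
        galerkin_system psi c b H h q0 p0 q1 p1 Q P V) <->
     prk_system b a at_ H h q0 p0 q1 p1 Q P) /\
  symplectic_prk b a at_ U H h.
Proof.
move=> phi b a at_; have H_diff z : U z.1 -> differentiable H z by case/H_C2.
split; first exact: nodal_basis_delta.
split=> [E X branch Hd q0 p0 q1 p1|].
  exact: discrete_hamiltonian_galerkin (lt0r_neq0 h_gt0) b_neq0 H_diff _ _
    branch _ _ _ _.
split=> [q0 p0 q1 p1 Q P _|]; first exact: galerkin_prk_equiv.
exact: symplectic_prk_conj_coef.
Qed.
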